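(* Let $d \geq 1$ be an arbitrary integer and let $c : [0,1)^d \to \mathbb{R}$ be a potential with arccos-transform $\gamma : [-1,1]^d \to \mathbb{R}$. Assume that $\gamma$ is convex, and that $\gamma$ is increasing in the sense that if $\mathbf{s}^1, \mathbf{s}^2 \in [-1,1]^d$ satisfy $\mathbf{s}^1 \leq \mathbf{s}^2$ componentwise, then $\gamma(\mathbf{s}^1) \leq \gamma(\mathbf{s}^2)$. Then the set $$\mathcal{T}^d = \left\{\tfrac13 (k, \dots, k) : k = 0, 1, 2\right\} \subseteq [0,1)^d$$ minimizes $E_c$ among all $3$-point sets in $[0,1)^d$; that is, $E_c(X) \geq E_c(\mathcal{T}^d)$ for every $X \subseteq [0,1)^d$ with $\#X = 3$.
   Context: The torus is $[0,1)^d$ with opposite faces identified; functions on $[0,1)^d$ are regarded as functions on $\mathbb{R}^d$ that are $1$-periodic in each coordinate. A potential is a function $c : [0,1)^d \to \mathbb{R}$, $1$-periodic in every component (i.e. extended periodically to $\mathbb{R}^d$), such that $c(t_1,\dots,t_d) = c(t_{\tau(1)},\dots,t_{\tau(d)})$ for every permutation $\tau$ of $\{1,\dots,d\}$ and $c(t_1,t_2,\dots,t_d) = c(1-t_1,t_2,\dots,t_d)$ for all $\mathbf{t} \in [0,1)^d$. For a finite set $X \subseteq [0,1)^d$, the tensor product energy is the sum over ordered pairs of distinct points $$E_c(X) = \sum_{\substack{\mathbf{x}, \mathbf{y} \in X \\ \mathbf{x} \neq \mathbf{y}}} c(\mathbf{x}-\mathbf{y}).$$ The arccos-transform of a potential $c$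 is the function $$\gamma : [-1,1]^d \to \mathbb{R}, \qquad \gamma(s_1,\dots,s_d) = c\left(\frac{\arccos s_1}{2\pi}, \dots, \frac{\arccos s_d}{2\pi}\right),$$ where $\arccos$ takes values in $[0,\pi]$. *)

(* Defs.v *)
(* MathComp-Analysis. *)
From HB Require Import structures.
From mathcomp Require Import all_boot all_order all_algebra all_fingroup finmap.
From mathcomp Require Import all_classical all_reals all_analysis.

Set Implicit Arguments.
Unset Strict Implicit.
Unset Printing Implicit Defensive.

Import Order.TTheory GRing.Theory Num.Theory.

Local Open Scope classical_set_scope.
Local Open Scope ring_scope.

Section TensorProductEnergy.
Variables (R : realType) (d : nat).
Implicit Types (c : 'rV[R]_d -> R) (s t x y : 'rV[R]_d) (X Y : {fset 'rV[R]_d}).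

Definition torus : set 'rV[R]_d := [set t | forall i, 0 <= t 0 i < 1].

Definition reflect_first t : 'rV[R]_d :=
  \row_i (if i == 0%N :> nat then 1 - t 0 i else t 0 i).

(* A function on [0,1)^d is represented by its periodic extension to R^d,
   so that c (x - y) makes sense for arbitrary x and y in [0,1)^d. *)
Record potential c : Prop := Potential {
  potential_periodic : forall i : 'I_d, periodic c (delta_mx 0 i);
  potential_sym : forall (tau : 'S_d) t, torus t -> c (col_perm tau t) = c t;
  potential_reflect : forall t, torus t -> c (reflect_first t) = c t }.

Definition energy c X : R := \sum_(x <- X) \sum_(y <- X | x != y) c (x - y).

Definition cube : set 'rV[R]_d := [set s | forall i, -1 <= s 0 i <= 1].

(* Only the values on [cube] are meaningful. *)
Definition arccos_transform c s : R := c (\row_i (acos (s 0 i) / (2 * pi))).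

Definition increasing_on_cube (g : 'rV[R]_d -> R) : Prop :=
  forall s1 s2, cube s1 -> cube s2 ->
    (forall i, s1 0 i <= s2 0 i) -> g s1 <= g s2.

Definition diagonal_thirds : {fset 'rV[R]_d} :=
  [fset const_mx (k%:R / 3) | k in [:: 0; 1; 2]%N]%fset.

Definition energy_minimizer c (n : nat) X : Prop :=
  [/\ [set` X] `<=` torus, #|` X| = n &
      forall Y, [set` Y] `<=` torus -> #|` Y| = n -> energy c X <= energy c Y].

End TensorProductEnergy.

Arguments torus {R d}.
Arguments cube {R d}.

(* Main.v *)
Require Import Defs.
From mathcomp Require Import all_boot all_order all_algebra finmap.
From mathcomp Require Import all_classical all_reals all_analysis.
From mathcomp Require Import perm zify lra ring.

(** Extended periodically, [c] is symmetric in its coordinates and even in each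
    of them, so [c x] depends only on the cosines of the angles [2 * pi * x_i]:
    [c x] is the arccos-transform [g] at the point of the cube with these
    coordinates ([potential_arccosE]).  The energy of three points [x], [y], [z]
    is then twice the sum of the values of [g] at the cosine vectors of the three
    differences [x - y], [y - z], [z - x], which add up to zero
    ([energy_triple]).

    By Jensen's inequality ([convex_mean3]) this sum is at least three times [g]
    at the mean of the cosine vectors.  In each coordinate the three angles add
    up to zero, so their cosines add up to at least [- 3 / 2]
    ([cos_triple_ge]): the mean dominates the constant vector [- 1 / 2], and [g]
    is increasing.  Since [- 1 / 2] is the cosine of a third of a turn, the
    resulting bound [6 * g (- 1 / 2, ...)] is [6 * c (1 / 3, ...)]
    ([potential_triangle_ge]).  The diagonal thirds attain it, because two
    distinct points among them differ by [(1 / 3, ...)] up to sign and integer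
    translations. *)

Set Implicit Arguments.
Unset Strict Implicit.

Import Order.TTheory GRing.Theory Num.Theory.

Local Open Scope ring_scope.

(** * Cosines of angles adding up to zero *)

(** Twice [3 / 2 + cos a + cos b + cos (a + b)] is the sum of squares
    [(1 + cos a + cos b) ^ 2 + (sin a - sin b) ^ 2]. *)
Lemma cos_triple_ge (R : realType) (a b : R) :
  - (3 / 2) <= cos a + cos b + cos (a + b).
Proof.
have ha := cos2Dsin2 a; have hb := cos2Dsin2 b.
have h1 := sqr_ge0 (1 + cos a + cos b); have h2 := sqr_ge0 (sin a - sin b).
rewrite cosD; nra.
Qed.

(** The angle [t = 2 * pi / 3] satisfies [2 * t = 2 * pi - t], so its cosine is a
    root of [2 X ^ 2 - X - 1], and it is not the root [1]. *)
Lemma cos_third_turn (R : realType) : cos (2 * pi / 3) = - (1 / 2) :> R.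
Proof.
have pi0 := @pi_gt0 R.
set t := 2 * pi / 3.
have dbl : cos (t *+ 2) = cos t.
  have -> : t *+ 2 = - t + pi *+ 2 by rewrite /t; field.
  by rewrite cosD2pi cosN.
have lt1 : cos t < 1.
  by rewrite -cos0 ltr_cos ?in_itv /=; rewrite /t; lra.
rewrite cos_mulr2n in dbl.
have : (cos t - 1) * (2 * cos t + 1) = 0.
  by rewrite mulr2n in dbl; lra.
by move/eqP; rewrite mulf_eq0 => /orP[/eqP|/eqP]; lra.
Qed.

Lemma cosD2pi_int (R : realType) (x : R) (n : int) :
  cos (x + 2 * pi * n%:~R) = cos x.
Proof.
case: n => n.
  have -> : x + 2 * pi * (Posz n)%:~R = x + pi *+ 2 *+ n.
    by rewrite -[(pi *+ 2) *+ n]mulr_natr -[pi *+ 2]mulr_natl.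
  exact: periodicn (@cosD2pi R) _ _.
rewrite NegzE mulrNz mulrN.
rewrite -(periodicn (@cosD2pi R) n.+1); congr cos.
by rewrite -[(pi *+ 2) *+ _]mulr_natr -[pi *+ 2]mulr_natl addrNK.
Qed.

(** Folding a circle onto half of it: [b] tells whether the fractional part of
    [u] exceeds [1 / 2], in which case the fold is a reflection. *)
Lemma acos_cos_turn (R : realType) (u : R) :
  exists b : bool, exists n : int,
    acos (cos (2 * pi * u)) / (2 * pi) = (-1) ^+ b * u + n%:~R.
Proof.
have pi0 := @pi_gt0 R.
have /andP[] := floor_itv u; set m := Num.floor u; rewrite intrD => lem ltm.
have -> : cos (2 * pi * u) = cos (2 * pi * (u - m%:~R)).
  by rewrite -(cosD2pi_int (2 * pi * (u - _)) m) -mulrDr subrK.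
have [le2|gt2] := leP (u - m%:~R) (1 / 2).
  exists false, (- m); rewrite cosK ?in_itv /=; last by apply/andP; split; nra.
  by rewrite mulrNz expr0 mul1r mulrC mulKf // mulf_neq0 ?lt0r_neq0.
exists true, (m + 1).
have -> : cos (2 * pi * (u - m%:~R)) = cos (2 * pi * (1 - (u - m%:~R))).
  rewrite -cosN -(cosD2pi_int (- _) 1); congr cos; ring.
rewrite cosK ?in_itv /=; last by apply/andP; split; nra.
rewrite mulrC mulKf ?mulf_neq0 ?lt0r_neq0 // intrD expr1; ring.
Qed.

(** * Jensen's inequality for three points of the cube *)

(** Two-point convexity is used twice, writing the mean as the combination of [x]
    and the midpoint of [y] and [z] with weights [1 / 3] and [2 / 3]; convexity
    of [D] puts that midpoint in the domain. *)
Lemma convex_mean3 (R : realType) (E : lmodType R) (D : set E) (f : E -> R)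
    (x y z : E) :
  convex_set D -> convex_function D f -> D x -> D y -> D z ->
  f (3^-1 *: (x + y + z)) <= (f x + f y + f z) / 3.
Proof.
move=> cD cf /mem_set Dx /mem_set Dy /mem_set Dz.
have h3 : 0 <= 3^-1 :> R by lra.
have h3' : 3^-1 <= 1 :> R by lra.
have h2 : 0 <= 2^-1 :> R by lra.
have h2' : 2^-1 <= 1 :> R by lra.
have := cf (Itv01 h3 h3') _ _ Dx (cD _ _ (Itv01 h2 h2') Dy Dz).
have := cf (Itv01 h2 h2') _ _ Dy Dz.
rewrite !convRE /conv /= /unstable.onem => fyz fxyz.
have -> : 3^-1 *: (x + y + z) =
    3^-1 *: x + (1 - 3^-1) *: (2^-1 *: y + (1 - 2^-1) *: z).
  rewrite -addrA !scalerDr !scalerA; congr (_ + (_ *: _ + _ *: _)); lra.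
lra.
Qed.

Lemma convex_cube (R : realType) (d : nat) : convex_set (@cube R d).
Proof.
move=> x y t /set_mem cx /set_mem cy; apply/mem_set => i.
rewrite /conv /= !mxE /unstable.onem.
have := cx i; have := cy i; have : 0 <= t%:num by []; have : t%:num <= 1 by [].
move=> t1 t0 /andP[? ?] /andP[? ?]; apply/andP; split; nra.
Qed.

(** * Symmetries of a potential on the whole space *)

Section Symmetries.
Variables (R : realType) (d : nat) (c : 'rV[R]_d -> R).
Hypothesis hc : potential c.

Lemma potential_int_shift (x v : 'rV[R]_d) :
  (forall i, v 0 i \is a Num.int) -> c (x + v) = c x.
Proof.
move=> vint; rewrite (row_sum_delta v); move: x.
elim/big_rec: _ => [x|i w _ IH x]; first by rewrite addr0.
rewrite addrA IH; have /intrP[n ->] := vint i.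
have shift_nat (k : nat) y : c (y + k%:R *: delta_mx 0 i) = c y.
  by rewrite scaler_nat periodicn //; exact: potential_periodic hc i.
case: n => n; first exact: shift_nat.
rewrite NegzE mulrNz scaleNr -[LHS](shift_nat n.+1); congr c.
by rewrite addrNK.
Qed.

Lemma potential_congr_int (x y : 'rV[R]_d) :
  (forall i, y 0 i - x 0 i \is a Num.int) -> c y = c x.
Proof.
move=> xy; have yE : y = x + (y - x) by rewrite addrC subrK.
by rewrite yE; apply: potential_int_shift => i; rewrite !mxE.
Qed.

(** The symmetries of a potential are assumed on the torus only; replacing a point
    by its fractional part extends them to the whole space. *)
Definition frac_row (x : 'rV[R]_d) : 'rV[R]_d :=
  \row_i (x 0 i - (Num.floor (x 0 i))%:~R).

Lemma torus_frac_row x : torus (frac_row x).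
Proof.
move=> i; rewrite mxE; have /andP[] := floor_itv (x 0 i).
rewrite intrD => *; apply/andP; split; lra.
Qed.

Lemma potential_frac_row x : c (frac_row x) = c x.
Proof.
by apply: potential_congr_int => i; rewrite mxE addrAC subrr add0r rpredN intr_int.
Qed.

Lemma potential_perm (tau : {perm 'I_d}) (x : 'rV[R]_d) :
  c (col_perm tau x) = c x.
Proof.
rewrite -[RHS]potential_frac_row -(potential_sym hc tau (torus_frac_row x)).
by apply: potential_congr_int => i; rewrite !mxE opprB addrCA subrr addr0 intr_int.
Qed.

Definition negate_at (i : 'I_d) (x : 'rV[R]_d) : 'rV[R]_d :=
  \row_j (if j == i then - x 0 j else x 0 j).

(** Up to integers, the reflection [1 - t] of a coordinate is its opposite. *)
Lemma potential_negate_first (i : 'I_d) (x : 'rV[R]_d) :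
  i = 0%N :> nat -> c (negate_at i x) = c x.
Proof.
move=> i0.
rewrite -[RHS]potential_frac_row -(potential_reflect hc (torus_frac_row x)).
apply: potential_congr_int => j; have j0 : ((j : nat) == 0%N) = (j == i).
  by rewrite -i0 val_eqE.
rewrite !mxE j0; case: eqP => _; last by rewrite opprB addrCA subrr addr0 intr_int.
set n := (_)%:~R; have -> : - x 0 j - (1 - (x 0 j - n)) = - (1 + n) by ring.
by rewrite rpredN rpredD ?rpred1 ?intr_int.
Qed.

(** Conjugating by a transposition moves the evenness in the first coordinate to
    any other one. *)
Lemma potential_negate_at (i : 'I_d) (x : 'rV[R]_d) :
  c (negate_at i x) = c x.
Proof.
pose i0 := Ordinal (leq_ltn_trans (leq0n i) (ltn_ord i)).
rewrite -[RHS](potential_perm (tperm i0 i)) -[RHS](@potential_negate_first i0) //.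
rewrite -[LHS](potential_perm (tperm i0 i)); congr c.
apply/rowP => j; rewrite !mxE.
by rewrite (can2_eq (tpermK i0 i) (tpermK i0 i)) tpermR.
Qed.

Lemma potential_signs (b : 'I_d -> bool) (x : 'rV[R]_d) :
  c (\row_i ((-1) ^+ b i * x 0 i)) = c x.
Proof.
(* Sign changes are applied one coordinate at a time, along [s]. *)
suff partial (s : seq 'I_d) : uniq s ->
    c (\row_i ((-1) ^+ ((i \in s) && b i) * x 0 i)) = c x.
  rewrite -[RHS](partial (enum 'I_d)) ?enum_uniq //; congr c.
  by apply/rowP => i; rewrite !mxE mem_enum.
elim: s => [_|k s IH] /=.
  by congr c; apply/rowP => i; rewrite !mxE mul1r.
move=> /andP[ks us]; rewrite -[RHS]IH //.
have [bk|bk] := boolP (b k); [rewrite -[RHS](potential_negate_at k)|];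
  congr c; apply/rowP => i; rewrite !mxE in_cons; case: eqP => //= ->;
  by rewrite (negbTE ks) /= ?bk ?(negbTE bk) ?expr1 ?expr0 ?mulN1r ?mul1r.
Qed.

(** Passing from [x_i] to [acos (cos (2 * pi * x_i)) / (2 * pi)] amounts to a sign
    change and an integer translation in each coordinate. *)
Lemma potential_arccosE (x : 'rV[R]_d) :
  c x = arccos_transform c (\row_i cos (2 * pi * x 0 i)).
Proof.
have [b acosE] := choice (fun i => acos_cos_turn (x 0 i)).
rewrite /arccos_transform -(potential_signs b x).
apply/esym/potential_congr_int => i; rewrite !mxE; have [n ->] := acosE i.
by rewrite addrAC subrr add0r intr_int.
Qed.

Lemma potentialN (x : 'rV[R]_d) : c (- x) = c x.
Proof.
rewrite -[RHS](potential_signs (fun=> true)); congr c.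
by apply/rowP => i; rewrite !mxE mulN1r.
Qed.

(** * Energy of three points *)

(** By evenness each unordered pair counts twice; the differences are arranged
    cyclically so that they add up to zero. *)
Lemma energy_triple (X : {fset 'rV[R]_d}) : #|` X| = 3%N ->
  exists x y z, [/\ x \in X, y \in X, z \in X, uniq [:: x; y; z] &
    energy c X = 2 * (c (x - y) + c (y - z) + c (z - x))].
Proof.
move=> cardX; have [x [y [z EX]]] : exists x y z, enum_fset X = [:: x; y; z].
  by case: (enum_fset X) cardX => [|x [|y [|z []]]] // _; exists x, y, z.
have XE t : (t \in X) = (t \in [:: x; y; z]) by rewrite -EX.
have := fset_uniq X; rewrite EX => xyz.
exists x, y, z; rewrite !XE !inE !eqxx !orbT; split=> //.
move: xyz; rewrite /= !inE negb_or andbT => /andP[/andP[xy xz] yz].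
rewrite /energy EX !big_cons !big_nil !eqxx xy xz yz.
rewrite (eq_sym y x) (eq_sym z x) (eq_sym z y) xy xz yz /=.
rewrite -[c (x - z)]potentialN -[c (y - x)]potentialN -[c (z - y)]potentialN.
rewrite !opprB; ring.
Qed.

Lemma potential_triangle_ge (u v w : 'rV[R]_d) :
  convex_function cube (arccos_transform c) ->
  increasing_on_cube (arccos_transform c) ->
  u + v + w = 0 -> 3 * c (const_mx (1 / 3)) <= c u + c v + c w.
Proof.
move=> hconv hincr uvw.
pose cosv (x : 'rV[R]_d) : 'rV[R]_d := \row_i cos (2 * pi * x 0 i).
have cube_cosv x : cube (cosv x) by move=> i; rewrite mxE cos_geN1 cos_le1.
have mean := convex_mean3 (@convex_cube R d) hconv
  (cube_cosv u) (cube_cosv v) (cube_cosv w).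
rewrite [c u]potential_arccosE [c v]potential_arccosE [c w]potential_arccosE.
rewrite [c (const_mx _)]potential_arccosE.
set m := 3^-1 *: _ in mean.
have le_m : arccos_transform c (cosv (const_mx (1 / 3))) <= arccos_transform c m.
  apply: hincr => //.
    have := cube_cosv u; have := cube_cosv v; have := cube_cosv w => hw hv hu i.
    have := hu i; have := hv i; have := hw i; rewrite /m !mxE.
    by move=> /andP[? ?] /andP[? ?] /andP[? ?]; apply/andP; split; lra.
  move=> i; rewrite /m !mxE.
  have -> : 2 * pi * (1 / 3) = 2 * pi / 3 :> R by field.
  have -> : 2 * pi * w 0 i = - (2 * pi * u 0 i + 2 * pi * v 0 i).
    have : (u + v + w) 0 i = 0 by rewrite uvw mxE.
    by rewrite !mxE => h; rewrite -mulrDr -mulrN; congr (_ * _); lra.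
  rewrite cosN cos_third_turn.
  have := cos_triple_ge (2 * pi * u 0 i) (2 * pi * v 0 i); lra.
rewrite /cosv in le_m mean *; lra.
Qed.

End Symmetries.

(** * The diagonal thirds *)

Lemma diagonal_thirdsP (R : realType) (d : nat) (x : 'rV[R]_d) :
  reflect (exists2 k : nat, (k < 3)%N & x = const_mx (k%:R / 3))
    (x \in diagonal_thirds R d).
Proof.
apply: (iffP (imfsetP _ _ _ _)) => [[k /=]|[k k3 ->]]; last first.
  by exists k => //=; rewrite !inE; case: k k3 => [|[|[|]]].
by rewrite !inE => /or3P[] /eqP-> ->; [exists 0%N|exists 1%N|exists 2%N].
Qed.

Lemma card_diagonal_thirds (R : realType) (d : nat) :
  (0 < d)%N -> #|` diagonal_thirds R d| = 3%N.
Proof.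
move=> d0; rewrite card_imfset //= => j k /rowP /(_ (Ordinal d0)).
rewrite !mxE => /(mulIf _); rewrite invr_neq0 // => /(_ isT) /eqP.
by rewrite eqr_nat => /eqP.
Qed.

Lemma torus_diagonal_thirds (R : realType) (d : nat) (x : 'rV[R]_d) :
  x \in diagonal_thirds R d -> torus x.
Proof.
case/diagonal_thirdsP => k k3 -> i; rewrite mxE divr_ge0 //=.
by rewrite ltr_pdivrMr // mul1r ltr_nat.
Qed.

Lemma potential_diagonal_thirds_sub (R : realType) (d : nat)
    (c : 'rV[R]_d -> R) (x y : 'rV[R]_d) :
  potential c -> x \in diagonal_thirds R d -> y \in diagonal_thirds R d ->
  x != y -> c (x - y) = c (const_mx (1 / 3)).
Proof.
move=> hc /diagonal_thirdsP[j j3 ->] /diagonal_thirdsP[k k3 ->].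
wlog jk : j k j3 k3 / (k <= j)%N.
  move=> H; case: (leqP k j) => [/H|/ltnW/H]; first exact.
  by rewrite eq_sym -opprB (potentialN hc); apply.
rewrite leq_eqVlt in jk; case/predU1P: jk => [->|jk _]; first by rewrite eqxx.
have [->|jk2] := eqVneq j (k + 1)%N.
  by congr c; apply/rowP => i; rewrite !mxE natrD -mulrBl addrAC subrr add0r.
(* The remaining difference is [2 / 3], which is [- (1 / 3)] modulo [1]. *)
have -> : j = 2%N by lia.
have -> : k = 0%N by lia.
rewrite -[LHS](potentialN hc); apply: potential_congr_int => // i; rewrite !mxE.
by rewrite (_ : _ - _ = - 1) ?rpredN ?rpred1 //; lra.
Qed.

Theorem theorem4 (R : realType) (d : nat) (hd : (1 <= d)%N)
    (c : 'rV[R]_d -> R) (hc : potential c)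
    (hconv : convex_function cube (arccos_transform c))
    (hincr : increasing_on_cube (arccos_transform c)) :
  energy_minimizer c 3 (diagonal_thirds R d).
Proof.
have cardT := card_diagonal_thirds R hd.
split=> //; first by move=> x /torus_diagonal_thirds.
move=> Y _ cardY.
have [x [y [z [Tx Ty Tz xyz ->]]]] := energy_triple hc cardT.
move: xyz; rewrite /= !inE negb_or andbT => /andP[/andP[xy xz] yz].
rewrite !(potential_diagonal_thirds_sub hc) // 1?eq_sym //.
have [u [v [w [_ _ _ _ ->]]]] := energy_triple hc cardY.
have uvw : (u - v) + (v - w) + (w - u) = 0 by rewrite !subrKA subrr.
have := potential_triangle_ge hc hconv hincr uvw; lra.
Qed.
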